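(* Consider a birth-death chain $X_m$ on a (possibly infinite) tree $\hat T$ with transition probabilities $p(\cdot,\cdot)$, let $T$ be a finite subtree of $\hat T$ with set of interior points $I$ and set of leaves $L$, and let $G$ be the Green's function of the chain stopped upon hitting $L$, as described in the context. Let $j,k\in I$ and let the unique path between $j$ and $k$ be determined by the vertices $v_1,\ldots,v_n$, so that $j\sim v_1$, $v_i\sim v_{i+1}$ for $1\le i\le n-1$, and $v_n\sim k$. Then $$\frac{G(j,k)}{G(k,j)}=\frac{p(j,v_1)\,p(v_1,v_2)\cdots p(v_{n-1},v_n)\,p(v_n,k)}{p(k,v_n)\,p(v_n,v_{n-1})\cdots p(v_2,v_1)\,p(v_1,j)}.$$
   Context: A birth-death chain on a tree $\hat T$ is a Markov chain $X_m$ ($m=0,1,2,\dots$) on the vertices of $\hat T$ whose transitions occur from a given vertex either to itself or to a neighboring vertex of the tree; $p(v,w)$ denotes the transition probability from $v$ to $w$, and $v\sim w$ means that $v$ and $w$ are neighbors. It is assumed that $p(v,w)>0$ whenever $v\sim w$. $T$ is a finite subtree of $\hat T$; $L$ is the set of leaves of $T$ and $I$ is the set of interior points (the non-leaf vertices) of $T$. Let $\tau=\inf\{m : X_m\in L\}$. For $x,y\in I$ the Green's function is $$G(x,y)=E_x\sum_{m=0}^{\tau}1_{\{X_m=y\}},$$ the expected number of visits to $y$, before time $\tau$, of the chain started at $x$. *)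

(* Defs.v *)
From HB Require Import structures.
From mathcomp Require Export all_boot all_order all_algebra.
From mathcomp Require Export all_classical all_reals all_analysis.

Set Implicit Arguments.
Unset Strict Implicit.
Unset Printing Implicit Defensive.

Import Order.TTheory GRing.Theory Num.Theory.
Local Open Scope classical_set_scope.
Local Open Scope ring_scope.

(* [fingraph.connect] is restricted to finite types, hence the explicit
   walks below. *)
Definition walk_in (V : choiceType) (adj : rel V) (A : set V)
    (x : V) (s : seq V) : Prop :=
  path adj x s /\ forall v, v \in x :: s -> A v.

(* The subgraph of the simple graph [adj] induced on [A] is a tree. This loses
   no generality for subtrees of a tree: a connected subgraph of an acyclic
   graph contains every edge between two of its vertices. *)
Record tree_on (V : choiceType) (adj : rel V) (A : set V) : Prop := TreeOn {
  tree_neq0 : A !=set0;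
  tree_sym : {in A &, forall x y, adj x y = adj y x};
  tree_irr : {in A, forall x, ~~ adj x x};
  tree_connected : forall x y, A x -> A y ->
    exists s, walk_in adj A x s /\ last x s = y;
  tree_acyclic : forall s : seq V, (2 < size s)%N ->
    (forall v, v \in s -> A v) -> ~ ucycle adj s }.

Definition leaves (V : choiceType) (adj : rel V) (T : set V) : set V :=
  [set v | T v /\ exists! w, T w /\ adj v w].

Definition interior_points (V : choiceType) (adj : rel V) (T : set V) : set V :=
  T `\` leaves adj T.

(* The tree need not be locally finite, so the rows of [p] are summed as
   possibly infinite sums. *)
Record birth_death (R : realType) (V : choiceType) (adj : rel V)
    (p : V -> V -> R) : Prop := BirthDeath {
  bd_ge0 : forall v w, 0 <= p v w;
  bd_sum1 : forall v, (\esum_(w in [set: V]) (p v w)%:E = 1)%E;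
  bd_nearest : forall v w, v != w -> ~~ adj v w -> p v w = 0;
  bd_gt0 : forall v w, adj v w -> 0 < p v w }.

(* [mc_step] is P(X_(m+1) = v_(m+1) | X_0 = v_0, ..., X_m = v_m)
   = p(v_m, v_(m+1)) multiplied by the probability of the conditioning event. *)
Record markov_chain_from (d : measure_display) (Omega : measurableType d)
    (R : realType) (V : choiceType) (P : probability Omega R)
    (X : nat -> Omega -> V) (p : V -> V -> R) (x : V) : Prop := MarkovChain {
  mc_measurable : forall m v, measurable [set o | X m o = v];
  mc_start : P [set o | X 0%N o = x] = 1%E;
  mc_step : forall (m : nat) (v : nat -> V),
    (P [set o | forall i, (i <= m.+1)%N -> X i o = v i] =
     P [set o | forall i, (i <= m)%N -> X i o = v i] *
       (p (v m) (v m.+1))%:E)%E }.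

(* [+oo] when the chain never visits [L]. *)
Definition hitting_time (Omega : Type) (R : realType) (V : choiceType)
    (X : nat -> Omega -> V) (L : set V) (o : Omega) : \bar R :=
  ereal_inf [set (m%:R : R)%:E | m in [set m | L (X m o)]].

Definition green (d : measure_display) (Omega : measurableType d)
    (R : realType) (V : choiceType) (P : V -> probability Omega R)
    (X : nat -> Omega -> V) (L : set V) (x y : V) : \bar R :=
  (\int[P x]_o
     \sum_(0 <= m <oo | (m%:R : R)%:E <= hitting_time R X L o)
       ((X m o == y)%:R : R)%:E)%E.

(* The product of [p] over the consecutive steps of [x :: s]. *)
Fixpoint path_weight (R : realType) (V : choiceType) (p : V -> V -> R)
    (x : V) (s : seq V) : R :=
  if s is y :: s' then p x y * path_weight p y s' else 1.

(* Main.v *)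
Require Import Defs.
From mathcomp Require Import measurable_realfun zify lra.

(* [G(j,k)] is the total weight of all walks from [j] to [k] that avoid the
   leaves; such walks may leave [T] through interior points, and they range
   over a possibly uncountable set.  By Kolmogorov's criterion on the tree, the
   ratio between the weight of a walk and that of its reversal depends only on
   the endpoints, hence reversing all walks gives
   [w(k -> j) G(j,k) = w(j -> k) G(k,j)].  The division is legitimate because
   [G(j,k)] is positive and finite: after each visit to [k] the chain goes
   straight to the leaves with probability at least some [c > 0], and these
   events are disjoint for different visits, so [c G(j,k) <= 1]. *)

Set Implicit Arguments.
Unset Strict Implicit.
Unset Printing Implicit Defensive.

Import Order.TTheory GRing.Theory Num.Theory.
Local Open Scope classical_set_scope.
Local Open Scope ring_scope.

(** * Walks, their weights and their reversals *)

(** A walk is encoded by its start [x] and its tail [s]; the reversed walk then starts at [last x s]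
    and has tail [rev (belast x s)]. *)
Lemma rev_belastE (V : Type) (x : V) (s : seq V) :
  last x s :: rev (belast x s) = rev (x :: s).
Proof. by rewrite (lastI x s) rev_rcons. Qed.

Lemma last_rev_belast (V : Type) (x : V) (s : seq V) :
  last (last x s) (rev (belast x s)) = x.
Proof. by case: s => //= y s; rewrite rev_cons last_rcons. Qed.

Lemma rev_belastK (V : Type) (x : V) (s : seq V) :
  rev (belast (last x s) (rev (belast x s))) = s.
Proof.
have := rev_belastE (last x s) (rev (belast x s)).
by rewrite [in RHS]rev_belastE revK => -[_ ->].
Qed.

Lemma path_weight_cat (R : realType) (V : choiceType) (p : V -> V -> R)
    (x : V) (s t : seq V) :
  path_weight p x (s ++ t) = path_weight p x s * path_weight p (last x s) t.
Proof. by elim: s x => [|y s IHs] x /=; rewrite ?mul1r// IHs mulrA. Qed.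

(** Transposing [p] lets a walk and its reversal be compared along one and the same sequence. *)
Lemma path_weight_rev (R : realType) (V : choiceType) (p : V -> V -> R)
    (x : V) (s : seq V) :
  path_weight p (last x s) (rev (belast x s)) =
  path_weight (fun v w => p w v) x s.
Proof.
elim: s x => [|y s IHs] x //=.
by rewrite rev_cons -cats1 path_weight_cat IHs last_rev_belast/= mulr1 mulrC.
Qed.

Lemma path_weight_ge0 (R : realType) (V : choiceType) (p : V -> V -> R)
    (x : V) (s : seq V) :
  (forall v w, 0 <= p v w) -> 0 <= path_weight p x s.
Proof. by move=> p0; elim: s x => [|y s IHs] x //=; rewrite mulr_ge0. Qed.

Lemma path_weight_gt0 (R : realType) (V : choiceType) (e : rel V)
    (p : V -> V -> R) (x : V) (s : seq V) :
  (forall v w, e v w -> 0 < p v w) -> path e x s -> 0 < path_weight p x s.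
Proof.
by move=> p0; elim: s x => [|y s IHs] x //= /andP[/p0 pxy /IHs]; exact: mulr_gt0.
Qed.

Lemma path_weight_eq0 (R : realType) (V : choiceType) (e : rel V)
    (p : V -> V -> R) (x : V) (s : seq V) :
  (forall v w, ~~ e v w -> p v w = 0) -> ~~ path e x s -> path_weight p x s = 0.
Proof.
move=> p0; elim: s x => [|y s IHs] x //=; rewrite negb_and.
by move=> /orP[/p0->|/IHs->]; rewrite ?mul0r ?mulr0.
Qed.

(** * Kolmogorov's criterion on a tree *)

Lemma path_lazy_uniq (V : eqType) (e : rel V) (x : V) (s : seq V) :
  uniq (x :: s) -> path (fun v w => (v == w) || e v w) x s -> path e x s.
Proof.
elim: s x => [|y s IHs] x //; rewrite cons_uniq inE negb_or.
by case/andP=> /andP[/negPf/= xy _] us; rewrite xy => /andP[/= -> /IHs->].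
Qed.

Lemma not_uniqP (V : eqType) (s : seq V) :
  ~~ uniq s -> exists z a b c, s = a ++ z :: b ++ z :: c.
Proof.
elim: s => [|x s IHs] //=; rewrite negb_and negbK; case/orP => [|/IHs].
  by case/splitPr => b c; exists x, [::], b, c.
by case=> z [a [b [c ->]]]; exists z, (x :: a), b, c.
Qed.

(* Kolmogorov's criterion.  A closed walk with a repeated vertex splits into
   two shorter ones; without repetition it is a cycle of the graph, hence of
   length at most two. *)
Lemma closed_walk_weight (R : realType) (V : choiceType) (adj : rel V)
    (p : V -> V -> R) (x : V) (s : seq V) :
  tree_on adj [set: V] -> birth_death adj p -> last x s = x ->
  path_weight p x s = path_weight (fun v w => p w v) x s.
Proof.
(* The chain may stay put, so loops are added to [adj]; a walk with any other step has weight 0 in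
   both directions. *)
move=> hT hp; set step := fun v w => (v == w) || adj v w.
have adjC v w : adj v w = adj w v by apply: (tree_sym hT); rewrite in_setT.
have p0 v w : ~~ step v w -> p v w = 0.
  by rewrite negb_or => /andP[vw avw]; apply: (bd_nearest hp).
have pT0 v w : ~~ step v w -> p w v = 0.
  by move=> vw; apply: p0; rewrite /step eq_sym adjC.
have [n] := ubnP (size s); elim: n x s => // n IHn x s szs lsx.
have [ps|nps] := boolP (path step x s); last first.
  by rewrite (path_weight_eq0 p0 nps) (path_weight_eq0 pT0 nps).
have [us|/not_uniqP[z [a [b [c sE]]]]] := boolP (uniq s); last first.
  rewrite sE -cat_rcons -cat_rcons !path_weight_cat.
  rewrite !last_rcons.
  have -> : path_weight p z (rcons b z) =
            path_weight (fun v w => p w v) z (rcons b z).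
    apply: IHn; last by rewrite last_rcons.
    by move: szs; rewrite sE !(size_cat, size_rcons)/= ?size_cat/=; lia.
  rewrite mulrCA [RHS]mulrCA; congr (_ * _).
  have := IHn x (rcons a z ++ c); rewrite !path_weight_cat last_rcons; apply.
    by move: szs; rewrite sE !(size_cat, size_rcons)/= ?size_cat/=; lia.
  by rewrite -lsx sE !last_cat !last_rcons/= last_cat.
case: s szs lsx ps us => [|y1 [|y2 [|y3 s]]] //=.
- by move=> _ -> _ _.
- by move=> _ -> _ _; rewrite !mulr1 mulrC.
move=> szs lsx /andP[xy1 ps] us.
case: (tree_acyclic hT (s := [:: y1, y2, y3 & s])) => //.
apply/andP; split; last by [].
(* Consecutive vertices of [s] are distinct, so its lazy steps are edges. The closing step starts at
   [x], the last entry of [s]; staying there would repeat [x] in [s]. *)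
rewrite (cycle_path x); move: (path_lazy_uniq us ps) => /= ->.
rewrite lsx andbT.
case/orP: xy1 => // /eqP xy1; case/andP: us => /negP[].
by rewrite -xy1 -[X in X \in _]lsx inE mem_last orbT.
Qed.

(** * Paths to the leaves and between interior points *)

(** As long as its end is not a leaf, a simple path in [T] with at least one edge extends to a new
    vertex, because returning to an old one would close a cycle. Finiteness of [T] stops the
    process. *)
Lemma exists_walk_to_leaf (V : choiceType) (adj : rel V) (T : set V)
    (x : V) (s : seq V) :
  finite_set T -> tree_on adj T -> path adj x s -> uniq (x :: s) ->
  (forall v, v \in x :: s -> T v) -> s != [::] ->
  exists2 t, path adj x t & leaves adj T (last x t).
Proof.
move=> /finite_seqP[r TE] hT.
have [n] := ubnP (size r - size s)%N; elim: n s => // n IHn s szs ps us sT.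
case/lastP: s szs ps us sT => [//|s y] szs ps us sT _.
have Ty : T y by apply: sT; rewrite inE mem_rcons mem_head orbT.
have [yL|yNL] := pselect (leaves adj T y).
  by exists (rcons s y) => //; rewrite last_rcons.
move: (ps); rewrite rcons_path => /andP[ps' adjsy].
set u := last x s in adjsy.
have Tu : T u by apply: sT; rewrite -rcons_cons mem_rcons inE mem_last orbT.
have adjyu : adj y u by rewrite (tree_sym hT) ?mem_set.
have [w Tw [adjyw wu]] : exists2 w, T w & adj y w /\ w != u.
  apply: contrapT => now; apply: yNL; split=> //; exists u; split=> // w [Tw yw].
  by apply/eqP; rewrite eq_sym; apply: contrapT => /negP wu; apply: now; exists w.
have [|wNs] := boolP (w \in x :: rcons s y); last first.
  apply: (IHn (rcons (rcons s y) w)); last by case: (s).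
  - have : (size (x :: rcons s y) <= size r)%N.
      by apply: uniq_leq_size us _ => v /sT; rewrite TE.
    by move: szs => /=; rewrite !size_rcons; lia.
  - by rewrite rcons_path ps last_rcons.
  - by rewrite -rcons_cons rcons_uniq wNs.
  - move=> v; rewrite -rcons_cons mem_rcons inE => /orP[/eqP->//|]; exact: sT.
move=> /[dup] wys; rewrite -rcons_cons mem_rcons inE => /orP[/eqP wy|wxs].
  by move: adjyw; rewrite wy (negPf (tree_irr hT _)) ?mem_set.
(* The stretch of the path from [w] to [y], closed by the edge from [y] to [w], is a cycle; [w != u]
   gives it at least three vertices. *)
have [a [b xsE]] : exists a b, x :: s = a ++ w :: b.
  by case/splitPr: wxs => a b; exists a, b.
have uE : u = last w b by rewrite /u -(last_cons x) xsE last_cat.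
have : uniq (w :: rcons b y).
  by move: us; rewrite -rcons_cons xsE rcons_cat cat_uniq => /and3P[].
have : path adj w (rcons b y).
  move: ps; have -> : path adj x (rcons s y) = sorted adj (rcons (x :: s) y) by [].
  rewrite xsE rcons_cat/=.
  by case: (a) => //= z a'; rewrite cat_path/= => /and3P[].
have bT v : v \in w :: rcons b y -> T v.
  by move=> vb; apply: sT; rewrite -rcons_cons xsE rcons_cat mem_cat orbC vb.
move=> pb ub.
case: (tree_acyclic hT (s := w :: rcons b y)) => //.
  rewrite /= size_rcons; case: (b) uE => // uw.
  by move: wu; rewrite uw eqxx.
by apply/andP; split=> //=; rewrite rcons_path pb last_rcons.
Qed.

Lemma exists_first_hit (V : choiceType) (adj : rel V) (L : set V)
    (x : V) (s : seq V) :
  path adj x s -> ~ L x -> L (last x s) ->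
  exists a l, [/\ path adj x (rcons a l), forall v, v \in x :: a -> ~ L v & L l].
Proof.
elim: s x => [//|y s IHs] x /= /andP[xy ps] xL lL.
have [yL|yNL] := pselect (L y).
  by exists [::], y; split; rewrite ?rcons_path//= ?xy// => v; rewrite inE => /eqP->.
have [a [l [pa aL Ll]]] := IHs y ps yNL lL.
exists (y :: a), l; split=> //=; first by rewrite xy.
by move=> v; rewrite inE => /orP[/eqP->//|]; exact: aL.
Qed.

Definition avoiding_walks (V : choiceType) (L : set V) (x y : V) :
    set (seq V) :=
  [set s | last x s = y /\ forall v, v \in x :: s -> ~ L v].

(* The inner vertices of a simple path have two neighbors in [T]. *)
Lemma exists_interior_walk (V : choiceType) (adj : rel V) (T : set V)
    (x y : V) :
  tree_on adj T -> interior_points adj T x -> interior_points adj T y ->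
  exists s, [/\ path adj x s, uniq (x :: s), forall v, v \in x :: s -> T v &
    avoiding_walks (leaves adj T) x y s].
Proof.
move=> hT [Tx xL] [Ty yL].
have [t [[pt tT] lt]] := tree_connected hT Tx Ty.
case/shortenP: pt lt => s ps us st ls.
have sT v : v \in x :: s -> T v.
  by move=> vs; apply: tT; move: vs; rewrite !inE => /orP[->//|/st ->]; rewrite orbT.
exists s; split=> //; split=> // v; rewrite inE => /orP[/eqP->//|vs].
case/splitPr: vs ps us ls sT => a b; case: b => [|w b].
  by rewrite last_cat/= => _ _ -> _.
move=> ps us _ sT [Tv [z [_ zuniq]]].
have Tl : T (last x a) by apply: sT; rewrite -cat_cons mem_cat mem_last.
have Tw : T w by apply: sT; rewrite -cat_cons mem_cat !inE eqxx !orbT.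
move: ps; rewrite cat_path/= => /and4P[_ lv vw _].
have vl : adj v (last x a) by rewrite (tree_sym hT) ?mem_set.
have lw : last x a = w by rewrite -(zuniq w)// -(zuniq (last x a)).
move: us; rewrite -cat_cons cat_uniq => /and3P[_ /hasPn/(_ w)].
by rewrite -lw mem_last inE lw !inE eqxx orbT => /(_ isT).
Qed.

(** * Unordered sums of walk weights and cylinder probabilities *)

(** Finite subsums give one inequality; for [c > 0] the other is the same inequality for the factor
    [c^-1]. *)
Lemma ge0_esumZl (R : realType) (I : choiceType) (S : set I)
    (a : I -> \bar R) (c : R) :
  0 <= c -> (forall i, 0 <= a i)%E ->
  (\esum_(i in S) (c%:E * a i) = c%:E * \esum_(i in S) a i)%E.
Proof.
move=> c0 a0.
have le_esumZl (b : R) (f : I -> \bar R) : 0 <= b -> (forall i, 0 <= f i)%E ->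
    (\esum_(i in S) (b%:E * f i) <= b%:E * \esum_(i in S) f i)%E.
  move=> b0 f0; apply: ge_ereal_sup => _ [F [finF FS] <-].
  rewrite -ge0_mule_fsumr//; apply: lee_pmul => //.
    by apply: fsume_ge0.
  by apply: esum_ge; exists F.
apply/eqP; rewrite eq_le le_esumZl//=.
have [->|c_neq0] := eqVneq c 0.
  by rewrite mul0e esum_ge0// => i _; rewrite mul0e.
have cV : 0 < c by rewrite lt0r c_neq0.
rewrite -lee_pdivlMl//; apply: le_trans (le_esumZl c^-1 _ _ _).
- by apply: le_esum => i _; rewrite muleA -EFinM mulVf// mul1e.
- by rewrite invr_ge0.
- by move=> i; rewrite mule_ge0.
Qed.

(** Induction on the length, splitting off the first step: the remaining walks have total weight 1,
    and so does each row of [p]. *)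
Lemma esum_path_weight (R : realType) (V : choiceType) (adj : rel V)
    (p : V -> V -> R) (x : V) (n : nat) :
  birth_death adj p ->
  (\esum_(s in [set s | size s = n]) (path_weight p x s)%:E = 1)%E.
Proof.
move=> hp; have w0 y s : (0 <= (path_weight p y s)%:E)%E.
  by rewrite lee_fin path_weight_ge0//; exact: bd_ge0 hp.
elim: n x => [|n IHn] x.
  rewrite (_ : [set s | size s = 0%N] = [set [::]]) ?esum_set1//.
  by apply/seteqP; split=> s /=; [case: s|move=> ->].
transitivity (\esum_(y in [set: V]) \esum_(s in [set s | size s = n])
    ((p x y)%:E * (path_weight p y s)%:E))%E; last first.
  rewrite -(bd_sum1 hp x); apply: eq_esum => y _.
  by rewrite ge0_esumZl ?IHn ?mule1//; exact: (bd_ge0 hp).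
rewrite esum_esum; last first.
  by move=> y s _ _; rewrite mule_ge0// lee_fin; exact: (bd_ge0 hp).
rewrite (@reindex_esum _ _ _ ([set: V] `*`` fun=> [set s : seq V | size s = n])
  _ (fun ys => ys.1 :: ys.2)).
  by apply: eq_esum => -[y s] _; rewrite -EFinM.
split.
- by move=> [y s] [_ /= <-].
- by move=> [y s] [z t] _ _ /= [-> ->].
- by move=> [|y s] //= [ys]; exists (y, s).
Qed.

Definition cylinder (Omega : Type) (V : Type) (X : nat -> Omega -> V) (x : V)
    (s : seq V) : set Omega :=
  [set o | forall i, (i <= size s)%N -> X i o = nth x (x :: s) i].

Lemma measurable_cylinder (d : measure_display) (Omega : measurableType d)
    (V : choiceType) (X : nat -> Omega -> V) (x : V) (s : seq V) :
  (forall m v, measurable [set o | X m o = v]) -> measurable (cylinder X x s).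
Proof.
move=> mX.
rewrite (_ : cylinder X x s = \bigcap_(i in `I_(size s).+1)
    [set o | X i o = nth x (x :: s) i]).
  by apply: fin_bigcap_measurable.
by apply/seteqP; split.
Qed.

Lemma probability_cylinder (d : measure_display) (Omega : measurableType d)
    (R : realType) (V : choiceType) (P : probability Omega R)
    (X : nat -> Omega -> V) (p : V -> V -> R) (x : V) (s : seq V) :
  markov_chain_from P X p x -> P (cylinder X x s) = (path_weight p x s)%:E.
Proof.
move=> hX; elim/last_ind: s => [|s y IHs].
  rewrite -[RHS](mc_start hX); congr (P _).
  apply/seteqP; split=> o /=; first exact.
  by move=> Xx i; rewrite leqn0 => /eqP->.
rewrite -cats1 path_weight_cat/= mulr1 EFinM -IHs cats1.
have := mc_step hX (size s) (nth x (x :: rcons s y)).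
have nthE i : (i <= size s)%N -> nth x (x :: rcons s y) i = nth x (x :: s) i.
  by rewrite -rcons_cons nth_rcons/= ltnS => ->.
rewrite nthE// -last_nth [nth x (x :: rcons s y) (size s).+1]/=.
rewrite nth_rcons ltnn eqxx.
rewrite /cylinder size_rcons => ->.
congr (P _ * _)%E; apply/seteqP; split=> o Xo i ile.
  by rewrite Xo// nthE.
by rewrite Xo// nthE.
Qed.

(** The sum is a supremum over finite subfamilies, whose unions of cylinders are measurable; an
    uncountable union need not be. *)
Lemma esum_path_weight_le (d : measure_display) (Omega : measurableType d)
    (R : realType) (V : choiceType) (P : probability Omega R)
    (X : nat -> Omega -> V) (p : V -> V -> R) (x : V) (S : set (seq V))
    (A : set Omega) :
  markov_chain_from P X p x -> trivIset S (cylinder X x) -> measurable A ->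
  (forall s, S s -> cylinder X x s `<=` A) ->
  (\esum_(s in S) (path_weight p x s)%:E <= P A)%E.
Proof.
move=> hX tS mA SA; apply: ge_ereal_sup => _ [F [finF FS] <-].
have mC s : measurable (cylinder X x s).
  by apply: measurable_cylinder; exact: mc_measurable hX.
rewrite (_ : (\sum_(s \in F) (path_weight p x s)%:E)%R =
             P (\bigcup_(s in F) cylinder X x s)).
  apply: le_measure; rewrite ?inE//; first exact: fin_bigcup_measurable.
  by apply: bigcup_sub => s /FS /SA.
rewrite measure_fin_bigcup//; last exact: sub_trivIset tS.
by apply: eq_fsbigr => s _; exact: esym (probability_cylinder s hX).
Qed.

(* The walks of length [n] have total weight 1, so the upper bound
   [esum_path_weight_le] for the walks inside [A] and for those inside its
   complement forces equality. *)
Lemma esum_path_weightE (d : measure_display) (Omega : measurableType d)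
    (R : realType) (V : choiceType) (adj : rel V) (P : probability Omega R)
    (X : nat -> Omega -> V) (p : V -> V -> R) (x : V) (n : nat)
    (S : set (seq V)) (A : set Omega) :
  birth_death adj p -> markov_chain_from P X p x -> measurable A ->
  (forall s, size s = n -> S s -> cylinder X x s `<=` A) ->
  (forall s, size s = n -> ~ S s -> cylinder X x s `<=` ~` A) ->
  (\esum_(s in [set s | size s = n /\ S s]) (path_weight p x s)%:E = P A)%E.
Proof.
move=> hp hX mA SA SNA.
have w0 s : (0 <= (path_weight p x s)%:E)%E.
  by rewrite lee_fin path_weight_ge0//; exact: bd_ge0 hp.
have tn : trivIset [set s | size s = n] (cylinder X x).
  move=> s t /= sn tn [w [sw tw]]; apply: (@eq_from_nth _ x).
    by rewrite sn tn.
  by move=> i isz; rewrite -[LHS](sw i.+1)// (tw i.+1)// tn -sn.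
have leA : (\esum_(s in [set s | size s = n /\ S s]) (path_weight p x s)%:E
    <= P A)%E.
  apply: (esum_path_weight_le hX) => //; last by move=> s []; exact: SA.
  by apply: sub_trivIset tn => s [].
have leAC : (\esum_(s in [set s | size s = n /\ ~ S s]) (path_weight p x s)%:E
    <= 1 - P A)%E.
  rewrite -probability_setC//.
  apply: (esum_path_weight_le hX) => //; last by move=> s []; exact: SNA.
  - by apply: sub_trivIset tn => s [].
  - exact: measurableC.
apply/eqP; rewrite eq_le leA/=.
have := esum_path_weight x n hp.
rewrite (esumID S)//.
set a := (X in (X + _)%E = _ -> _); set b := (X in (_ + X)%E = _ -> _).
rewrite -[X in (_ <= X)%E]/a => ab.
have Pfin : P A \is a fin_num by rewrite fin_num_measure.
have : (b <= 1 - P A)%E by [].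
have a0 : (0 <= a)%E by apply: esum_ge0.
have b0 : (0 <= b)%E by apply: esum_ge0.
move: ab a0 b0 Pfin; case: a b (P A) => [a||] [b||] [q||] //=.
rewrite -!EFinD !lee_fin => -[ab] _ _ _ bq; lra.
Qed.

(** * The Green's function as a sum over walks, its finiteness and its reversal *)

Lemma le_hitting_time (Omega : Type) (R : realType) (V : choiceType)
    (X : nat -> Omega -> V) (L : set V) (m : nat) (o : Omega) :
  ((m%:R : R)%:E <= hitting_time R X L o)%E <->
  (forall i, (i < m)%N -> ~ L (X i o)).
Proof.
split=> [mtau i im Li|NL].
  have : ((m%:R : R)%:E <= (i%:R : R)%:E)%E.
    by apply: le_trans mtau _; apply: ereal_inf_lbound; exists i.
  by rewrite lee_fin ler_nat leqNgt im.
apply: le_ereal_inf_tmp => _ [i Li <-]; rewrite lee_fin ler_nat leqNgt.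
by apply/negP => /NL.
Qed.

Lemma cylinder_avoiding (Omega : Type) (V : choiceType)
    (X : nat -> Omega -> V) (L : set V) (x y : V) (s : seq V) (o : Omega) :
  cylinder X x s o ->
  avoiding_walks L x y s <->
  (forall i, (i <= size s)%N -> ~ L (X i o)) /\ X (size s) o = y.
Proof.
move=> Xs; rewrite (Xs (size s))// -last_nth.
split=> -[].
  move=> ls sL; split=> //.
  by move=> i isz; rewrite Xs//; apply: sL; exact: mem_nth.
move=> sL ls; split=> // v /(nthP x)[i isz <-].
by rewrite -Xs//; exact: sL.
Qed.

(** The integral is exchanged with the sum over times. The term of time [m] is the probability of
    [E m], hence the weight of the avoiding walks of length [m]; the lengths partition all avoiding
    walks. *)
Lemma green_esum (d : measure_display) (Omega : measurableType d)
    (R : realType) (V : choiceType) (adj : rel V)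
    (P : V -> probability Omega R) (X : nat -> Omega -> V) (p : V -> V -> R)
    (L : set V) (x y : V) :
  birth_death adj p -> markov_chain_from (P x) X p x -> finite_set L -> ~ L y ->
  green P X L x y =
  (\esum_(s in avoiding_walks L x y) (path_weight p x s)%:E)%E.
Proof.
move=> hp hX finL yL.
pose E m := [set o | (forall i, (i <= m)%N -> ~ L (X i o)) /\ X m o = y].
have mE m : measurable (E m).
  (* Measurability is given for single states only; finiteness of [L] extends it to avoiding [L]. *)
  rewrite (_ : E m = \bigcap_(i in `I_m.+1) ~` (\bigcup_(l in L)
      [set o | X i o = l]) `&` [set o | X m o = y]).
    apply: measurableI; last exact: mc_measurable hX _ _.
    apply: fin_bigcap_measurable => // i _; apply: measurableC.
    by apply: fin_bigcup_measurable => // l _; exact: mc_measurable hX _ _.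
  apply/seteqP; split=> o [oL oy]; split=> // i im.
    by move=> [l Ll Xl]; apply: (oL i); rewrite ?Xl.
  by move=> LX; apply: (oL i im); exists (X i o).
transitivity (\int[P x]_o (\sum_(0 <= m <oo) (\1_(E m) o)%:E))%E.
  apply: eq_integral => o _; rewrite eseries_mkcond.
  apply: eq_eseriesr => m _; rewrite indicE.
  (* The condition up to the hitting time forbids [L] strictly before [m], while [E m] forbids it at
     [m] as well; they agree on [X m o = y] since [y] is not in [L]. *)
  have [mtau|mtau] := boolP (_ <= _)%E.
    congr (_%:R%:E); congr nat_of_bool; apply/eqP/idP; last by rewrite inE => -[].
    move=> Xm; rewrite inE; split=> // i; rewrite leq_eqVlt => /orP[/eqP->|].
      by rewrite Xm.
    exact: (le_hitting_time R X L m o).1.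
  rewrite memNset//= => -[oL _]; move/negP: mtau; apply.
  by apply/le_hitting_time => i im; apply: oL; exact: ltnW.
rewrite integral_nneseries//; last first.
  by move=> m; apply/measurable_EFinP; exact: measurable_indic.
transitivity (\sum_(0 <= m <oo) \esum_(s in [set s | size s = m /\
    avoiding_walks L x y s]) (path_weight p x s)%:E)%E.
  apply: eq_eseriesr => m _; rewrite integral_indic// setIT.
  apply/esym/(esum_path_weightE hp hX (mE m)) => s sm.
    by move=> sL o so; rewrite /E -sm; apply/(cylinder_avoiding _ _ so).
  by move=> sL o so; rewrite /= /E -sm => /(cylinder_avoiding _ _ so).
have w0 s : (0 <= (path_weight p x s)%:E)%E.
  by rewrite lee_fin path_weight_ge0//; exact: bd_ge0 hp.
rewrite nneseries_esumT; last by move=> m; exact: esum_ge0.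
rewrite -esum_bigcupT//.
  congr esum; apply/seteqP; split=> s; first by move=> [m _ []].
  by move=> sL; exists (size s).
by move=> m n _ _ [s [[<- _] [<- _]]].
Qed.

(* A walk avoiding [L] up to [y] continues along a fixed path to [L]; the
   resulting cylinders are disjoint since each one stops at the first visit
   of [L]. *)
Lemma esum_avoiding_walks_fin_num (d : measure_display)
    (Omega : measurableType d) (R : realType) (V : choiceType) (adj : rel V)
    (P : probability Omega R) (X : nat -> Omega -> V) (p : V -> V -> R)
    (L : set V) (x y l : V) (a : seq V) :
  birth_death adj p -> markov_chain_from P X p x ->
  path adj y (rcons a l) -> (forall v, v \in a -> ~ L v) -> L l ->
  (\esum_(s in avoiding_walks L x y) (path_weight p x s)%:E \is a fin_num)%E.
Proof.
move=> hp hX pa aL Ll.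
have w0 s : (0 <= (path_weight p x s)%:E)%E.
  by rewrite lee_fin path_weight_ge0//; exact: bd_ge0 hp.
rewrite ge0_fin_numE; last exact: esum_ge0.
set c := path_weight p y (rcons a l).
have c0 : 0 < c by apply: path_weight_gt0 pa; exact: (bd_gt0 hp).
suff : (c%:E * (\esum_(s in avoiding_walks L x y) (path_weight p x s)%:E)
    <= 1)%E.
  rewrite -lee_pdivlMl// mule1 => /le_lt_trans; apply; exact: ltry.
pose f s := s ++ rcons a l.
have f_inj : injective f.
  move=> s t /(congr1 rev)/eqP; rewrite !rev_cat eqseq_cat// eqxx/=.
  by move=> /eqP /(can_inj revK).
rewrite -ge0_esumZl//; last exact: ltW.
rewrite -(probability_setT P).
pose S := f @` avoiding_walks L x y.
apply: (@le_trans _ _ (\esum_(s in S) (path_weight p x s)%:E)%E).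
  rewrite (@reindex_esum _ _ _ (avoiding_walks L x y) S f).
    apply: le_esum => s [ls _].
    by rewrite /f path_weight_cat ls -/c EFinM muleC.
  by split; [move=> s /= sA; exists s|move=> s t _ _; exact: f_inj|].
apply: (esum_path_weight_le hX) => //.
(* The first visit of [L] on the cylinder of [f s] reveals the length of [s], so two cylinders that
   meet have equal length and thus coincide. *)
have hitE s o : avoiding_walks L x y s -> cylinder X x (f s) o ->
    L (X (size s + size a).+1 o) /\
    forall i, (i <= size s + size a)%N -> ~ L (X i o).
  move=> [_ sL]; rewrite /cylinder /f -rcons_cat size_rcons size_cat => Xs.
  split; first by rewrite Xs//= nth_rcons size_cat ltnn eqxx.
  move=> i im; rewrite Xs ?leqW//.
  have isz : (i < size (x :: s ++ a))%N by rewrite /= size_cat ltnS.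
  rewrite -rcons_cons nth_rcons isz.
  have := mem_nth x isz; rewrite -cat_cons mem_cat => /orP[/sL//|/aL//].
move=> _ _ [s sA <-] [t tA <-] [w [sw tw]].
have [[Ls NLs] [Lt NLt]] := (hitE s w sA sw, hitE t w tA tw).
have szst : size s = size t.
  have [st|ts|//] := ltngtP (size s) (size t).
    by case: (NLt _ _ Ls); rewrite -addSn leq_add2r.
  by case: (NLs _ _ Lt); rewrite -addSn leq_add2r.
have szf : size (f s) = size (f t) by rewrite !size_cat szst.
apply: (@eq_from_nth _ x) => // i isz.
by rewrite -[LHS](sw i.+1)// (tw i.+1)// -szf.
Qed.

(* Reversal matches the walks from [j] to [k] with those from [k] to [j], and
   by Kolmogorov's criterion it multiplies all weights by the same ratio. *)
Lemma esum_avoiding_walks_rev (R : realType) (V : choiceType) (adj : rel V)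
    (p : V -> V -> R) (L : set V) (j k : V) (t : seq V) :
  tree_on adj [set: V] -> birth_death adj p -> last j t = k ->
  ((path_weight (fun v w => p w v) j t)%:E *
     (\esum_(s in avoiding_walks L j k) (path_weight p j s)%:E) =
   (path_weight p j t)%:E *
     (\esum_(s in avoiding_walks L k j) (path_weight p k s)%:E))%E.
Proof.
move=> hT hp lt.
have w0 q x s : (forall v w, 0 <= q v w) -> 0 <= @path_weight R V q x s.
  exact: path_weight_ge0.
have p0 : forall v w, 0 <= p v w := bd_ge0 hp.
rewrite -!ge0_esumZl ?w0//; try by move=> s; rewrite lee_fin w0.
rewrite [RHS](@reindex_esum _ _ _ (avoiding_walks L j k) _
  (fun s => rev (belast j s))); last first.
  split.
  - move=> s [ls sL]; split; first by rewrite -ls last_rev_belast.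
    by move=> v; rewrite -ls rev_belastE mem_rev; exact: sL.
  - move=> s s' /set_mem[ls _] /set_mem[ls' _] ss'.
    by rewrite -[s](rev_belastK j) -[s'](rev_belastK j) ls ls' ss'.
  - move=> s [ls sL]; exists (rev (belast k s)).
      split; first by rewrite -ls last_rev_belast.
      by move=> v; rewrite -ls rev_belastE mem_rev; exact: sL.
    by rewrite -{1}ls rev_belastK.
apply: eq_esum => s [ls _]; rewrite -!EFinM; congr EFin.
rewrite -[in RHS]ls path_weight_rev.
(* The closed walk goes from [j] to [k] along [s] and back along the reversal of [t]. *)
have := @closed_walk_weight R V adj p j (s ++ rev (belast j t)) hT hp.
rewrite last_cat ls -lt last_rev_belast => /(_ erefl).
rewrite !path_weight_cat ls -lt !path_weight_rev.
by rewrite mulrC => ->; rewrite mulrC.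
Qed.

Theorem theorem2 (R : realType) (V : choiceType) (adj : rel V)
  (p : V -> V -> R) (d : measure_display) (Omega : measurableType d)
  (P : V -> probability Omega R) (X : nat -> Omega -> V)
  (T : set V) (j k : V) (vs : seq V)
  (hThat : tree_on adj [set: V])
  (hp : birth_death adj p)
  (hX : forall x, markov_chain_from (P x) X p x)
  (hTfin : finite_set T)
  (hT : tree_on adj T)
  (hj : interior_points adj T j)
  (hk : interior_points adj T k)
  (hpath : path adj j (rcons vs k))
  (huniq : uniq (j :: rcons vs k)) :
  (green P X (leaves adj T) j k / green P X (leaves adj T) k j =
   (path_weight p j (rcons vs k) / path_weight p k (rcons (rev vs) j))%R%:E)%E.
Proof.
have finL : finite_set (leaves adj T) by apply: sub_finite_set hTfin => v [].
have [jL kL] := (proj2 hj, proj2 hk).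
rewrite (green_esum hp (hX j) finL kL) (green_esum hp (hX k) finL jL).
have := esum_avoiding_walks_rev (leaves adj T) hThat hp (last_rcons j vs k).
have [s [ps us sT sA]] := exists_interior_walk hT hj hk.
set a := (\esum_(s in avoiding_walks _ j k) _)%E.
set b := (\esum_(s in avoiding_walks _ k j) _)%E.
have w0 x t : (0 <= (path_weight p x t)%:E)%E.
  by rewrite lee_fin path_weight_ge0//; exact: bd_ge0 hp.
have jk : j != k by move: huniq; rewrite /= mem_rcons inE negb_or => /andP[/andP[]].
have a_gt0 : (0 < a)%E.
  apply: (@lt_le_trans _ _ (path_weight p j s)%:E).
    by rewrite lte_fin (path_weight_gt0 _ ps)//; exact: (bd_gt0 hp).
  apply: esum_ge; exists [set s]; last by rewrite fsbig_set1.
  by split=> // _ ->.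
have a_fin : (a \is a fin_num)%E.
  (* The path from [k] to [j], nonempty as [j != k], serves as a start to be prolonged to a leaf;
     cutting at the first leaf gives an escape route from [k]. *)
  have [r [pr ur rT rA]] := exists_interior_walk hT hk hj.
  have r0 : r != [::].
    by case: (r) rA => // -[/= kj]; move: jk; rewrite kj eqxx.
  have [t pt lt] := exists_walk_to_leaf hTfin hT pr ur rT r0.
  have [q [l [pq qL Ll]]] := exists_first_hit pt kL lt.
  apply: (esum_avoiding_walks_fin_num hp (hX j) pq _ Ll) => v vq.
  by apply: qL; rewrite inE vq orbT.
have revE : path_weight p k (rcons (rev vs) j) =
            path_weight (fun v w => p w v) j (rcons vs k).
  by rewrite -[RHS]path_weight_rev last_rcons belast_rcons rev_cons.
rewrite revE; set w' := path_weight (fun v w => p w v) _ _.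
set w := path_weight p _ _.
have w_gt0 : 0 < w by apply: path_weight_gt0 hpath; exact: (bd_gt0 hp).
have w'_gt0 : 0 < w'.
  apply: path_weight_gt0 hpath => x y xy; apply: (bd_gt0 hp).
  by rewrite (tree_sym hThat) ?in_setT.
have b_ge0 : (0 <= b)%E by exact: esum_ge0.
(* The reversal identity transfers positivity and finiteness from [a] to [b]: [b = 0] would force
   [w' * a = 0], and [b = +oo] would make the finite [w' * a] infinite. *)
move: a b a_gt0 a_fin b_ge0 => [a||] [b||]//.
  rewrite lte_fin => a_gt0 _ _; rewrite -!EFinM => -[ab].
  have b_neq0 : b != 0.
    apply/eqP => b0; move: ab; rewrite b0 mulr0 => /eqP.
    by rewrite mulf_eq0 !gt_eqF.
  rewrite inver (negPf b_neq0) -EFinM; congr EFin.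
  apply/eqP; rewrite eqr_div//; last by rewrite gt_eqF.
  by rewrite mulrC ab.
by rewrite gt0_muley ?lte_fin// -EFinM.
Qed.
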